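(* Let $P$ be an $n\times n$ irreducible stochastic matrix and let $E$ be a real $n\times n$ matrix with $E\mathbf{1}=0$ and $\|E\|_\infty\le1$. Set $P(\epsilon)=P+\epsilon E$ and assume that $P(\epsilon)$ is stochastic for all sufficiently small $\epsilon>0$. Then for any vector $\mathbf{h}$ with $\mathbf{h}^T\mathbf{1}=1$, as $\epsilon\to0^+$, $$|\kappa(P(\epsilon))-\kappa(P)|\le\epsilon\,\|(I-P+\mathbf{1}\mathbf{h}^T)^{-2}\|_F\,\|E\|_F+O(\epsilon^2).$$
   Context: A square nonnegative matrix $P$ is stochastic if $P\mathbf{1}=\mathbf{1}$, where $\mathbf{1}$ is the all-ones vector. $\|\cdot\|_\infty$ is the matrix norm induced by the vector infinity norm (maximum absolute row sum) and $\|\cdot\|_F$ the Frobenius norm. The $O(\epsilon^2)$ means: there are $C,\epsilon_0>0$ (depending on $P,E,\mathbf{h}$) such that the inequality holds with $C\epsilon^2$ in place of $O(\epsilon^2)$ for $0<\epsilon<\epsilon_0$. For small $\epsilon>0$, $P(\epsilon)$ is irreducible because $P$ is. Kemeny's constant of an irreducible stochastic $N\times N$ matrix $Q$ with eigenvalues $\lambda_1=1,\lambda_2,\dots,\lambda_N$ (with algebraic multiplicity) is $\kappa(Q)=\sum_{i=2}^N\frac{1}{1-\lambda_i}$; equivalently $\kappa(Q)=\operatorname{Tr}\big((I-Q+\mathbf{1}\mathbf{h}^T)^{-1}\big)-1$ for any $\mathbf{h}$ with $\mathbf{h}^T\mathbf{1}=1$. *)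

(* Defs.v *)
From HB Require Import structures.
From mathcomp Require Import all_boot all_order all_algebra.
From mathcomp Require Import reals complex.
Set Implicit Arguments.
Unset Strict Implicit.
Unset Printing Implicit Defensive.
Import Order.TTheory GRing.Theory Num.Theory.
Local Open Scope ring_scope.
Local Open Scope complex_scope.

Definition stochastic (R : realType) (n : nat) (P : 'M[R]_n) : Prop :=
  (forall i j, 0 <= P i j) /\ P *m (const_mx 1 : 'cV[R]_n) = const_mx 1.

(* Irreducibility of a nonnegative matrix: every state reaches every state. *)
Definition irreducible_mx (R : realType) (n : nat) (P : 'M[R]_n) : Prop :=
  forall i j, exists k : nat, 0 < (P ^+ k) i j.

Definition norm_inf (R : realType) (n : nat) (A : 'M[R]_n) : R :=
  \big[Num.max/0]_(i < n) \sum_(j < n) `|A i j|.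

Definition norm_frob (R : realType) (n : nat) (A : 'M[R]_n) : R :=
  Num.sqrt (\sum_(i < n) \sum_(j < n) `|A i j| ^+ 2).

(* The complex eigenvalues of a real matrix, listed with algebraic
   multiplicity (in an unspecified order). *)
Definition eigenvalues (R : realType) (n : nat) (Q : 'M[R]_n) : seq R[i] :=
  sval (closed_field_poly_normal (char_poly (map_mx (real_complex R) Q))).

Lemma eigenvaluesP (R : realType) (n : nat) (Q : 'M[R]_n) :
  char_poly (map_mx (real_complex R) Q) =
  \prod_(z <- eigenvalues Q) ('X - z%:P).
Proof.
rewrite /eigenvalues; case: closed_field_poly_normal => s /= ->.
by rewrite (monicP (char_poly_monic _)) scale1r.
Qed.

(* [rem 1] removes one occurrence of the eigenvalue 1; for an irreducible
   stochastic matrix that eigenvalue is present and simple, so no summand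
   is the junk value 0^-1 = 0.  The sum is kept in R[i], although its value
   is then real because the eigenvalues come in conjugate pairs. *)
Definition kemeny (R : realType) (n : nat) (Q : 'M[R]_n) : R[i] :=
  \sum_(z <- rem 1 (eigenvalues Q)) (1 - z)^-1.

(* Main.v *)
Require Import Defs.
From HB Require Import structures.
From mathcomp Require Import all_boot all_order all_algebra.
From mathcomp Require Import reals complex.
From mathcomp Require Import ring lra.
Set Implicit Arguments.
Unset Strict Implicit.
Unset Printing Implicit Defensive.
Import Order.TTheory GRing.Theory Num.Theory.
Local Open Scope ring_scope.
Local Open Scope complex_scope.

(* With M = I - P + 1 h^T, the eigenvalues of M are 1 and the 1 - lambda_i (i >= 2), so
   kappa(P) = tr M^-1 - 1.  Since E 1 = 0, the same formula holds for P + eps E with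
   M - eps E in place of M, and expanding the resolvent identity twice gives
     kappa(P + eps E) - kappa(P) = eps tr(M^-2 E) + eps^2 tr(M^-1 E M^-1 E (M - eps E)^-1).
   The first trace is bounded by Cauchy-Schwarz; the last factor stays bounded because
   (M - eps E)^-1 = M^-1 + eps M^-1 E (M - eps E)^-1.  Irreducibility enters only through
   the invertibility of M, which follows from the maximum principle. *)

(** * Characteristic polynomials and the trace formula for Kemeny's constant *)

(** A nonzero difference [p - q] would vanish at 1, 2, ..., [size (p - q)], more roots than its
    degree allows. Excluding 0 lets later determinant computations divide by [x]. *)
Lemma eq_poly_of_horner_nz (F : numFieldType) (p q : {poly F}) :
  (forall x, x != 0 -> p.[x] = q.[x]) -> p = q.
Proof.
move=> pq; apply/eqP; rewrite -subr_eq0.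
apply: contraT => nz.
pose rs := mkseq (fun i => i.+1%:R : F) (size (p - q)).
have urs : uniq rs by rewrite mkseq_uniq // => i j /eqP; rewrite eqr_nat eqSS => /eqP.
have : (size rs < size (p - q)%R)%N.
  apply: max_poly_roots urs => //.
  apply/allP => x /mapP [i _ ->].
  by rewrite /root hornerD hornerN pq ?subrr // pnatr_eq0.
by rewrite size_mkseq ltnn.
Qed.

Lemma horner_char_poly (F : comNzRingType) (n : nat) (A : 'M[F]_n) (x : F) :
  (char_poly A).[x] = \det (x%:M - A).
Proof.
rewrite /char_poly -horner_evalE -det_map_mx; congr (\det _).
apply/matrixP=> i j; rewrite !mxE /= horner_evalE !hornerE.
by rewrite hornerMn hornerX.
Qed.

(** The block matrix with rows [(1, -v)] and [(u, 1)] has two block-triangular factorizations;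
    comparing their determinants gives the formula. *)
Lemma det_add1_rank1 (F : comPzRingType) (n : nat) (u : 'cV[F]_n) (v : 'rV[F]_n) :
  \det (1%:M + u *m v) = 1 + (v *m u) 0 0.
Proof.
have e : block_mx (1%:M : 'M_1) 0 u 1%:M *m block_mx 1%:M (- v) 0 (1%:M + u *m v) =
  block_mx (1%:M + v *m u) (- v) 0 1%:M *m block_mx 1%:M 0 u 1%:M.
  rewrite !mulmx_block !(mul1mx, mulmx1, mul0mx, mulmx0, add0r, addr0).
  by rewrite mulNmx addrK mulmxN addrCA addNr addr0.
have := congr1 determinant e.
rewrite !det_mulmx !det_lblock !det_ublock !det1 !mul1r !mulr1 => ->.
by rewrite det_mx11 !mxE eqxx.
Qed.

(* The characteristic polynomial of [A^-1] is the normalized reversal of that of [A]. *)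
Lemma char_poly_invmx (F : numFieldType) (n : nat) (A : 'M[F]_n) (s : seq F) :
  A \in unitmx -> char_poly A = \prod_(z <- s) ('X - z%:P) ->
  char_poly (invmx A) = \prod_(z <- s) ('X - (z^-1)%:P).
Proof.
move=> uA eA; have sz : size s = n.
  by have := congr1 (size \o val) eA; rewrite /= size_char_poly size_prod_XsubC => -[].
have hA x : \det (x%:M - A) = \prod_(z <- s) (x - z).
  by rewrite -horner_char_poly eA horner_prod; apply: eq_bigr => z _; rewrite !hornerE.
have dA : \det A != 0 by rewrite -unitfE -unitmxE.
have prodN (t : F) (G : F -> F) : \prod_(z <- s) (t * G z) = t ^+ n * \prod_(z <- s) G z.
  by rewrite big_split /= -sz big_const_seq count_predT iter_mulr_1.
have dA' : \det A = \prod_(z <- s) z.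
  have := hA 0; rewrite raddf0 sub0r -scaleN1r detZ.
  under eq_bigr => z _ do rewrite sub0r -mulN1r.
  rewrite prodN => /mulfI -> //.
  by rewrite signr_eq0.
have nzs z : z \in s -> z != 0.
  move=> zs; apply: contraNneq dA => z0; rewrite dA'.
  by rewrite (perm_big _ (perm_to_rem zs)) big_cons /= z0 mul0r.
apply: eq_poly_of_horner_nz => x x0.
(* Multiplying by [\det A] turns [x - A^-1] into [x A - 1 = - x (x^-1 - A)], whose determinant is
   read off from [hA] at [x^-1]. *)
rewrite horner_char_poly horner_prod; apply: (mulfI dA).
rewrite -det_mulmx mulmxBr mulmxV // mul_mx_scalar.
have -> : x *: A - 1%:M = (- x) *: (x^-1%:M - A).
  by rewrite scalerBr scale_scalar_mx mulNr mulfV // scaleNr opprK addrC raddfN.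
rewrite detZ hA -prodN dA' -big_split /= !big_seq; apply: eq_bigr => z /nzs z0.
by rewrite !hornerE; field; rewrite x0 z0.
Qed.

(** The subleading coefficient of the characteristic polynomial of [invmx A] is minus its trace, and
    also minus the sum of its roots. Size 0 is separate because that coefficient does not exist
    there. *)
Lemma mxtrace_invmx (F : numFieldType) (n : nat) (A : 'M[F]_n) (s : seq F) :
  A \in unitmx -> char_poly A = \prod_(z <- s) ('X - z%:P) ->
  \tr (invmx A) = \sum_(z <- s) z^-1.
Proof.
move=> uA eA; have eV := char_poly_invmx uA eA.
have sz : size s = n.
  by have := congr1 (size \o val) eA; rewrite /= size_char_poly size_prod_XsubC => -[].
case: n => [|n] in A uA eA eV sz *.
  by rewrite (size0nil sz) big_nil /mxtrace big_ord0.
have := char_poly_trace (invmx A) isT.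
have s0 : size [seq z^-1 | z <- s] != 0%N by rewrite size_map sz.
have := coefPn_prod_XsubC s0; rewrite !big_map size_map sz eV => -> /oppr_inj.
exact: esym.
Qed.

(* [x I - (I - Q + 1 h^T) = - ((1 - x) I - Q) (I - x^-1 1 h^T)] because [Q 1 = 1],
   so the rank-one term only moves the eigenvalue [1 - 1] of [I - Q] to [1]. *)
Lemma char_poly_fundamental (F : numFieldType) (n : nat) (Q : 'M[F]_n)
    (h : 'cV[F]_n) (s : seq F) :
  Q *m (const_mx 1 : 'cV[F]_n) = const_mx 1 ->
  h^T *m (const_mx 1 : 'cV[F]_n) = 1%:M ->
  char_poly Q = \prod_(z <- s) ('X - z%:P) ->
  char_poly (1%:M - Q + (const_mx 1 : 'cV[F]_n) *m h^T) =
  \prod_(z <- 1 :: [seq 1 - z | z <- rem 1 s]) ('X - z%:P).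
Proof.
set e := const_mx 1 => Qe he eQ.
have sz : size s = n.
  by have := congr1 (size \o val) eQ; rewrite /= size_char_poly size_prod_XsubC => -[].
have hQ x : \det (x%:M - Q) = \prod_(z <- s) (x - z).
  by rewrite -horner_char_poly eQ horner_prod; apply: eq_bigr => z _; rewrite !hornerE.
have prodN (t : F) (G : F -> F) : \prod_(z <- s) (t * G z) = t ^+ n * \prod_(z <- s) G z.
  by rewrite big_split /= -sz big_const_seq count_predT iter_mulr_1.
have e0 : e != 0.
  apply: contra_eq_neq he => ->; rewrite mulmx0.
  by apply/eqP=> /matrixP /(_ 0 0); rewrite !mxE eqxx => /eqP; rewrite eq_sym oner_eq0.
(* Otherwise [1 - Q] would be invertible while killing [e != 0]. Hence [rem 1 s] really drops a
   root. *)
have s1 : 1 \in s.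
  rewrite -root_prod_XsubC -eQ /root horner_char_poly.
  apply: contraNT e0 => d0; apply/eqP.
  have u : 1%:M - Q \in unitmx by rewrite unitmxE unitfE.
  by rewrite -[e](mulKmx u) mulmxBl mul1mx Qe subrr mulmx0.
apply: eq_poly_of_horner_nz => x x0.
rewrite horner_char_poly horner_prod big_cons big_map !hornerE.
have -> : x%:M - (1%:M - Q + e *m h^T) =
   (- 1) *: (((1 - x)%:M - Q) *m (1%:M + e *m (- x^-1 *: h^T))).
  rewrite mulmxDr mulmx1 mulmxA mulmxBl mul_scalar_mx Qe.
  rewrite scalerBl scale1r [e - _]addrC addrK -scaleNr -scalemxAr -scalemxAl.
  rewrite scalerA mulrNN mulVf // scale1r scaleN1r raddfB /=.
  by rewrite !opprD !opprK [- _ + x%:M]addrC !addrA.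
rewrite detZ det_mulmx det_add1_rank1 -scalemxAl he !mxE eqxx hQ mulrA -prodN.
(* With its sign, the factor for the root 1 is [-1 * (1 - x - 1) = x]; times the rank-one
   determinant [1 - x^-1] it becomes [x - 1]. *)
rewrite (perm_big _ (perm_to_rem s1)) big_cons /=.
rewrite [in RHS](eq_bigr (fun z => -1 * (1 - x - z))); last first.
  by move=> z _; rewrite !hornerE; ring.
by rewrite mulr1n; field.
Qed.

(** Over [R[i]] the matrix has eigenvalues 1 and [1 - z] for the remaining eigenvalues [z] of [Q],
    so the trace of its inverse is 1 plus the sum defining [kemeny Q]. *)
Lemma kemeny_trace (R : realType) (n : nat) (Q : 'M[R]_n) (h : 'cV[R]_n) :
  Q *m (const_mx 1 : 'cV[R]_n) = const_mx 1 ->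
  h^T *m (const_mx 1 : 'cV[R]_n) = 1%:M ->
  1%:M - Q + (const_mx 1 : 'cV[R]_n) *m h^T \in unitmx ->
  kemeny Q = (\tr (invmx (1%:M - Q + (const_mx 1 : 'cV[R]_n) *m h^T)) - 1)%:C.
Proof.
set f := real_complex R => Qe he uM.
have f1 : map_mx f (const_mx 1 : 'cV_n) = const_mx 1.
  by apply/matrixP=> i j; rewrite !mxE.
have fQ : map_mx f Q *m (const_mx 1 : 'cV_n) = const_mx 1.
  by rewrite -f1 -map_mxM Qe.
have fh : (map_mx f h)^T *m (const_mx 1 : 'cV_n) = 1%:M.
  by rewrite -f1 map_trmx -map_mxM he map_mx1.
have fM : map_mx f (1%:M - Q + (const_mx 1 : 'cV_n) *m h^T) =
   1%:M - map_mx f Q + (const_mx 1 : 'cV_n) *m (map_mx f h)^T.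
  by rewrite map_mxD map_mxM f1 map_mxB map_mx1 -map_trmx.
have ch := char_poly_fundamental fQ fh (eigenvaluesP Q).
rewrite -fM in ch.
have ufM : map_mx f (1%:M - Q + (const_mx 1 : 'cV_n) *m h^T) \in unitmx.
  by rewrite map_unitmx.
have := mxtrace_invmx ufM ch.
rewrite big_cons big_map invr1 -map_invmx trace_map_mx => tr.
rewrite /kemeny -(addKr 1 (\sum_(z <- _) _)) -tr.
by rewrite -[RHS]/(f (_ - 1)) /f rmorphB rmorph1 addrC.
Qed.

(** * Invertibility of [I - P + 1 h^T] for irreducible [P] *)

(** [kermx] is a left kernel, so the argument passes to the transpose: rows of its kernel become
    columns killed by [A]. *)
Lemma unitmx_of_ker0 (F : fieldType) (n : nat) (A : 'M[F]_n) :
  (forall v : 'cV_n, A *m v = 0 -> v = 0) -> A \in unitmx.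
Proof.
move=> inj; rewrite -unitmx_tr -row_free_unit -kermx_eq0; apply/eqP/row_matrixP=> i.
apply: trmx_inj; rewrite row0 trmx0; apply: inj.
by rewrite -{1}[A]trmxK -trmx_mul -row_mul mulmx_ker row0 trmx0.
Qed.

Lemma stochastic_row_sum (R : realType) (n : nat) (P : 'M[R]_n) (i : 'I_n) :
  stochastic P -> \sum_j P i j = 1.
Proof.
move=> [_ /matrixP /(_ i 0)]; rewrite !mxE => <-.
by apply: eq_bigr => j _; rewrite mxE mulr1.
Qed.

Lemma stochastic_exp (R : realType) (n : nat) (P : 'M[R]_n) (k : nat) :
  stochastic P -> stochastic (P ^+ k).
Proof.
move=> [P0 P1]; elim: k => [|k [IH0 IH1]].
  split=> [i j|]; first by rewrite expr0 mxE ler0n.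
  by rewrite expr0 mul1mx.
split=> [i j|]; last by rewrite exprS -mulmxA IH1.
by rewrite exprS mxE sumr_ge0 // => l _; rewrite mulr_ge0.
Qed.

(* Maximum principle: evaluate at a maximal entry of [v]. *)
Lemma stochastic_shift_le0 (R : realType) (n : nat) (P : 'M[R]_n) (v : 'cV[R]_n) (c : R) :
  (0 < n)%N -> stochastic P -> P *m v = v + const_mx c -> c <= 0.
Proof.
case: n => [|n] // in P v *; move=> _ Pst /matrixP Pv.
case: (@arg_maxP _ _ _ (ord0 : 'I_n.+1) predT (fun i => v i 0) isT) => i _ vi.
have := Pv i 0; rewrite !mxE => e.
have : v i 0 + c <= v i 0; last by rewrite gerDl.
rewrite -e -[leRHS]mul1r -(stochastic_row_sum i Pst) mulr_suml.
by apply: ler_sum => j _; rewrite ler_wpM2l ?(proj1 Pst) //; apply: vi.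
Qed.

(** Let [v i] be maximal. Since [P ^+ k] fixes [v], the average of the nonnegative gaps [v i - v m]
    weighted by row [i] of [P ^+ k] is zero; choosing [k] with positive weight at [j] forces
    [v j = v i]. *)
Lemma irreducible_fixed_const (R : realType) (n : nat) (P : 'M[R]_n) (v : 'cV[R]_n) :
  stochastic P -> irreducible_mx P -> P *m v = v -> exists a, v = const_mx a.
Proof.
case: n => [|n] // in P v *; move=> Pst Pirr Pv.
  by exists 0; apply/matrixP => -[].
case: (@arg_maxP _ _ _ (ord0 : 'I_n.+1) predT (fun i => v i 0) isT) => i _ vi.
exists (v i 0); apply/matrixP => j l; rewrite ord1 mxE.
have [k Pk] := Pirr i j; have kst := stochastic_exp k Pst.
have Pkv : P ^+ k *m v = v.
  by elim: k {Pk kst} => [|k IH]; rewrite ?expr0 ?mul1mx // exprS -mulmxA IH.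
have : \sum_m (P ^+ k) i m * (v i 0 - v m 0) = 0.
  under eq_bigr do rewrite mulrBr.
  rewrite sumrB -mulr_suml stochastic_row_sum // mul1r.
  by move/matrixP: Pkv => /(_ i 0); rewrite mxE => ->; rewrite subrr.
move/eqP; rewrite psumr_eq0; last first.
  by move=> m _; rewrite mulr_ge0 ?(proj1 kst) // subr_ge0; apply: vi.
move/allP => /(_ j (mem_index_enum _)) /=.
by rewrite mulf_eq0 gt_eqF //= subr_eq0 => /eqP.
Qed.

(** A kernel vector [v] satisfies [P v = v + c 1] with [c = h^T v]. The maximum principle for [v]
    and [- v] gives [c = 0], so [v] is a constant vector, and [h^T 1 = 1] identifies the constant
    with [c]. *)
Lemma fundamental_unitmx (R : realType) (n : nat) (P : 'M[R]_n) (h : 'cV[R]_n) :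
  stochastic P -> irreducible_mx P -> h^T *m (const_mx 1 : 'cV[R]_n) = 1%:M ->
  1%:M - P + (const_mx 1 : 'cV[R]_n) *m h^T \in unitmx.
Proof.
move=> Pst Pirr he; apply: unitmx_of_ker0 => v.
have n0 : (0 < n)%N.
  case: n P h Pst Pirr he v => // P h _ _ /matrixP /(_ 0 0).
  by rewrite !mxE big_ord0 => /eqP; rewrite eq_sym oner_eq0.
set c := (h^T *m v) 0 0.
have hv : h^T *m v = c%:M by rewrite [LHS]mx11_scalar.
rewrite mulmxDl -mulmxA hv mul_mx_scalar mulmxBl mul1mx => /eqP Mv.
have Pv : P *m v = v + const_mx c.
  have -> : const_mx c = c *: (const_mx 1 : 'cV_n).
    by apply/matrixP=> i j; rewrite !mxE mulr1.
  by apply/eqP; rewrite eq_sym -subr_eq0 addrAC.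
have c0 : c = 0.
  apply/eqP; rewrite eq_le (stochastic_shift_le0 n0 Pst Pv) /=.
  rewrite -oppr_le0; apply: (stochastic_shift_le0 (v := - v) n0 Pst).
  rewrite mulmxN Pv opprD; congr (_ + _); by apply/matrixP=> i j; rewrite !mxE.
have [a va] : exists a, v = const_mx a.
  apply: (irreducible_fixed_const Pst Pirr); rewrite Pv c0.
  by apply/matrixP=> i j; rewrite !mxE addr0.
have va' : v = a *: const_mx 1 by rewrite va; apply/matrixP=> i j; rewrite !mxE mulr1.
move/matrixP: hv => /(_ 0 0); rewrite va' -scalemxAr he c0 !mxE eqxx mulr1 => ->.
by rewrite scale0r.
Qed.

(** * Entrywise and Frobenius norm estimates *)

(** Entrywise l1 norm, chosen for the remainder because it is submultiplicative and dominates the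
    trace. *)
Definition norm_sum (R : numDomainType) (m n : nat) (A : 'M[R]_(m, n)) : R :=
  \sum_i \sum_j `|A i j|.

Section NormSum.
Variable R : numDomainType.

Lemma norm_sum_ge0 m n (A : 'M[R]_(m, n)) : 0 <= norm_sum A.
Proof. by apply: sumr_ge0 => i _; apply: sumr_ge0. Qed.

Lemma norm_sum_eq0 m n (A : 'M[R]_(m, n)) : norm_sum A = 0 -> A = 0.
Proof.
move/eqP; rewrite psumr_eq0 => [/allP A0|i _]; last exact: sumr_ge0.
apply/matrixP=> i j; have := A0 i (mem_index_enum _).
rewrite psumr_eq0 // => /allP /(_ j (mem_index_enum _)).
by rewrite normr_eq0 mxE => /eqP.
Qed.

Lemma norm_sumD m n (A B : 'M[R]_(m, n)) :
  norm_sum (A + B) <= norm_sum A + norm_sum B.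
Proof.
rewrite /norm_sum -big_split; apply: ler_sum => i _ /=.
by rewrite -big_split; apply: ler_sum => j _ /=; rewrite mxE ler_normD.
Qed.

Lemma norm_sumZ m n a (A : 'M[R]_(m, n)) : norm_sum (a *: A) = `|a| * norm_sum A.
Proof.
rewrite /norm_sum mulr_sumr; apply: eq_bigr => i _.
by rewrite mulr_sumr; apply: eq_bigr => j _; rewrite mxE normrM.
Qed.

Lemma norm_sumM m n p (A : 'M[R]_(m, n)) (B : 'M[R]_(n, p)) :
  norm_sum (A *m B) <= norm_sum A * norm_sum B.
Proof.
have -> : norm_sum A * norm_sum B =
    \sum_i \sum_k `|A i k| * norm_sum B.
  by rewrite mulr_suml; apply: eq_bigr => i _; rewrite mulr_suml.
apply: ler_sum => i _.
apply: (@le_trans _ _ (\sum_j \sum_k `|A i k| * `|B k j|)).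
  apply: ler_sum => j _; rewrite mxE; apply: (le_trans (ler_norm_sum _ _ _)).
  by under eq_bigr do rewrite normrM.
rewrite exchange_big /=; apply: ler_sum => k _.
(* Row [k] of [B] is only one of the nonnegative row sums making up [norm_sum B]. *)
rewrite -mulr_sumr ler_wpM2l // /norm_sum (bigD1 k) //= lerDl.
by apply: sumr_ge0 => l _; apply: sumr_ge0.
Qed.

Lemma normr_mxtrace_le n (A : 'M[R]_n) : `|\tr A| <= norm_sum A.
Proof.
apply: (le_trans (ler_norm_sum _ _ _)); apply: ler_sum => i _.
by rewrite (bigD1 i) //= lerDl sumr_ge0.
Qed.

End NormSum.

(* Lagrange's identity: the defect is half of [\sum_(i, j) (f i * g j - f j * g i) ^+ 2]. *)
Lemma sqr_sum_mul_le (R : realFieldType) (I : finType) (f g : I -> R) :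
  (\sum_i f i * g i) ^+ 2 <= (\sum_i f i ^+ 2) * (\sum_i g i ^+ 2).
Proof.
have : 0 <= \sum_i \sum_j (f i * g j - f j * g i) ^+ 2.
  by apply: sumr_ge0 => i _; apply: sumr_ge0 => j _; apply: sqr_ge0.
have -> : \sum_i \sum_j (f i * g j - f j * g i) ^+ 2 =
   2 * ((\sum_i f i ^+ 2) * (\sum_i g i ^+ 2) - (\sum_i f i * g i) ^+ 2).
  set F := \sum_i f i ^+ 2; set G := \sum_i g i ^+ 2; set H := \sum_i f i * g i.
  transitivity (\sum_i (f i ^+ 2 * G - 2 * (f i * g i * H) + g i ^+ 2 * F)).
    apply: eq_bigr => i _; rewrite /F /G /H !mulr_sumr -sumrB -big_split /=.
    by apply: eq_bigr => j _; ring.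
  by rewrite big_split sumrB /= -!mulr_suml -mulr_sumr -mulr_suml; rewrite -/F -/G -/H; ring.
by rewrite pmulr_rge0 // subr_ge0.
Qed.

(** Cauchy-Schwarz over index pairs, since the trace is the sum of [A i j * B j i]. *)
Lemma mxtrace_mul_le_frob (R : realType) (n : nat) (A B : 'M[R]_n) :
  `|\tr (A *m B)| <= norm_frob A * norm_frob B.
Proof.
rewrite /norm_frob -sqrtrM; last first.
  by apply: sumr_ge0 => i _; apply: sumr_ge0 => j _; apply: sqr_ge0.
rewrite -sqrtr_sqr ler_wsqrtr // /mxtrace.
under eq_bigr do rewrite mxE.
rewrite [X in X ^+ 2](pair_bigA _ (fun i j => A i j * B j i)) /=.
apply: (le_trans (sqr_sum_mul_le _ _)).
(* Swapping the two indices removes the transposition of [B]. *)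
rewrite [X in _ * X <= _](reindex (fun p : 'I_n * 'I_n => (p.2, p.1))) /=; last first.
  by exists (fun p => (p.2, p.1)) => -[].
rewrite -!(pair_bigA _ (fun i j => _ i j ^+ 2)) /=.
by under eq_bigr do under eq_bigr do rewrite -real_normK ?num_real //;
   under [X in _ * X <= _]eq_bigr do under eq_bigr do rewrite -real_normK ?num_real //.
Qed.

(** * The inverse of a perturbed matrix *)

Section Resolvent.
Variables (R : realFieldType) (n : nat) (M E : 'M[R]_n).
Hypothesis uM : M \in unitmx.
Let Z := invmx M.

(** A kernel vector satisfies [v = eps Z E v], so a nonzero one would have norm strictly below
    itself. *)
Lemma unitmx_perturb eps : `|eps| * norm_sum (Z *m E) < 1 -> M - eps *: E \in unitmx.
Proof.
move=> small; apply: unitmx_of_ker0 => v /eqP.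
rewrite mulmxBl subr_eq0 => /eqP Mv.
have ve : v = eps *: (Z *m E) *m v.
  by rewrite -{1}[v](mulKmx uM) Mv -!scalemxAl -scalemxAr mulmxA.
apply: norm_sum_eq0; apply/eqP; apply: contraTT small => nv.
have pv : 0 < norm_sum v by rewrite lt_def nv norm_sum_ge0.
rewrite -leNgt -(ler_pM2r pv) mul1r {1}ve.
by apply: (le_trans (norm_sumM _ _)); rewrite norm_sumZ.
Qed.

Lemma resolvent_identity eps : M - eps *: E \in unitmx ->
  invmx (M - eps *: E) = Z + eps *: (Z *m E *m invmx (M - eps *: E)).
Proof.
move=> u; set W := invmx _.
have : (M - eps *: E) *m W = 1%:M by rewrite mulmxV.
rewrite mulmxBl => /eqP; rewrite subr_eq => /eqP MW.
rewrite -{1}[W](mulKmx uM) -/Z MW mulmxDr mulmx1.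
by rewrite -!scalemxAl -scalemxAr mulmxA.
Qed.

(** The resolvent identity bounds the norm of the inverse by [norm_sum Z] plus half of itself; the
    half is absorbed on the left. *)
Lemma norm_sum_invmx_perturb eps : `|eps| * norm_sum (Z *m E) <= 2^-1 ->
  norm_sum (invmx (M - eps *: E)) <= 2 * norm_sum Z.
Proof.
move=> small; have u : M - eps *: E \in unitmx.
  by apply: unitmx_perturb; apply: (le_lt_trans small); rewrite invf_lt1 ?ltr1n.
have := resolvent_identity u; set W := invmx (M - _) => eW.
have : norm_sum W <= norm_sum Z + `|eps| * norm_sum (Z *m E) * norm_sum W.
  rewrite {1}eW; apply: (le_trans (norm_sumD _ _)); rewrite lerD2l norm_sumZ -mulrA.
  by rewrite ler_wpM2l // norm_sumM.
have := ler_wpM2r (norm_sum_ge0 W) small.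
lra.
Qed.

End Resolvent.

(** * First-order bound for Kemeny's constant *)

Theorem mainTheorem8 (R : realType) (n : nat) (P E : 'M[R]_n) (h : 'cV[R]_n)
  (P_stoch : stochastic P) (P_irr : irreducible_mx P)
  (E_ones : E *m (const_mx 1 : 'cV[R]_n) = 0)
  (E_norm : norm_inf E <= 1)
  (Peps_stoch : exists2 d : R, 0 < d &
     forall eps : R, 0 < eps < d -> stochastic (P + eps *: E))
  (h_ones : h^T *m (const_mx 1 : 'cV[R]_n) = 1%:M) :
  exists C eps0 : R, [/\ 0 < C, 0 < eps0 &
    forall eps : R, 0 < eps < eps0 ->
      `|kemeny (P + eps *: E) - kemeny P| <=
      (eps * norm_frob (invmx (1%:M - P + (const_mx 1 : 'cV[R]_n) *m h^T) ^+ 2)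
           * norm_frob E + C * eps ^+ 2)%:C].
Proof.
have uM := fundamental_unitmx P_stoch P_irr h_ones.
set M := 1%:M - P + _ in uM *; set Z := invmx M.
pose a := norm_sum (Z *m E).
have a0 : 0 <= a by apply: norm_sum_ge0.
(* Bound for the coefficient of [eps ^+ 2], with the perturbed inverse estimated by
   [2 * norm_sum Z]. *)
pose K := norm_sum (Z *m E *m (Z *m E)) * (2 * norm_sum Z).
have K0 : 0 <= K by rewrite !mulr_ge0 ?norm_sum_ge0.
have a1 : 0 < 2 * (a + 1) by lra.
(* This range of [eps] gives [eps * a <= 1/2]; the added 1 keeps both witnesses well defined and
   positive when [K] or [a] is zero. *)
exists (K + 1), (2 * (a + 1))^-1; split; [lra | by rewrite invr_gt0|].
move=> eps /andP[e0 e1].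
have small : `|eps| * norm_sum (Z *m E) <= 2^-1.
  rewrite gtr0_norm // -/a; have : eps * (2 * (a + 1)) < 1.
    by rewrite -ltr_pdivlMr // div1r.
  nra.
have uMe : M - eps *: E \in unitmx.
  by apply: unitmx_perturb => //; apply: (le_lt_trans small); rewrite invf_lt1 ?ltr1n.
have Me : 1%:M - (P + eps *: E) + (const_mx 1 : 'cV_n) *m h^T = M - eps *: E.
  by rewrite /M opprD !addrA [LHS]addrAC.
rewrite (kemeny_trace (h := h) (proj2 P_stoch)) // -/M -/Z.
rewrite (kemeny_trace (h := h)) ?Me //; last first.
  by rewrite mulmxDl (proj2 P_stoch) -scalemxAl E_ones scaler0 addr0.
set W := invmx (M - _).
(* Both values are embedded reals, so the complex modulus reduces to the real absolute value. *)
rewrite -rmorphB normc_def /= expr0n addr0 sqrtr_sqr lecR.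
have -> : \tr W - 1 - (\tr Z - 1) =
   eps * \tr (Z ^+ 2 *m E) + eps ^+ 2 * \tr (Z *m E *m (Z *m E) *m W).
  have eW : W = Z + eps *: (Z *m E *m W) := resolvent_identity uM uMe.
  rewrite {1}eW {1}eW mulmxDr scalerDr -!scalemxAr scalerA !mxtraceD !mxtraceZ.
  (* Cyclicity of the trace turns the first-order term [Z E Z] into [Z ^+ 2 E]. *)
  rewrite !mulmxA [\tr (Z *m E *m Z)]mxtrace_mulC mulmxA -[Z *m Z]/(Z * Z) -expr2.
  ring.
apply: (le_trans (ler_normD _ _)); apply: lerD.
  by rewrite normrM gtr0_norm // -mulrA ler_pM2l // mxtrace_mul_le_frob.
rewrite normrM ger0_norm ?sqr_ge0 // mulrC ler_wpM2r ?sqr_ge0 //.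
apply: (le_trans (normr_mxtrace_le _)); apply: (le_trans (norm_sumM _ _)).
have := norm_sum_invmx_perturb uM small; rewrite -/W -/Z => Wle.
by apply: (@le_trans _ _ K); [rewrite /K ler_wpM2l // norm_sum_ge0 | lra].
Qed.
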